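(* Let $b\geq 2$ be an integer, and let $x_b=\sum_{a=1}^{b-1}\frac1a$ and $y_b=\sum_{a=2}^{b}\frac1a$. Then for all integers $\ell\geq 3$ and $m\geq 2$, $$s_b \;\geq\; \frac{b+2}{b+1}\,x_b+\frac{2y_b}{b^{\lceil \ell/2\rceil}-b^{\lceil \ell/2\rceil-1}}+\sum_{k=3}^{2\lceil \ell/2\rceil-1}s_{b,k},$$ $$s_b \;\leq\; \left(\frac{b+2}{b+1}+\frac{2}{b^{m}-b^{m-1}}+\sum_{k=\ell}^{2m-1}\frac{b^{\lceil (k-2)/2\rceil}}{b^{k-1}+1}\right)x_b+\sum_{k=3}^{\ell-1}s_{b,k}.$$
   Context: For an integer $b\geq 2$, a positive integer $n$ with base-$b$ expansion $n=(a_ka_{k-1}\cdots a_0)_b=\sum_{i=0}^k a_i b^i$, where $0\leq a_i\leq b-1$ and $a_k\neq 0$, is a $b$-adic palindrome if $a_{k-i}=a_i$ for all $0\leq i\leq k$. Let $P_b$ be the set of all $b$-adic palindromes. Define $s_b=\sum_{n\in P_b}\frac1n$ (this series converges), and for each integer $k\geq 1$ let $s_{b,k}=\sum_{n\in P_b,\ b^{k-1}\leq n<b^k}\frac1n$, the reciprocal sum of the $b$-adic palindromes having exactly $k$ digits in base $b$. $\lceil t\rceil$ denotes the smallest integer not less than $t$. Empty sums (for example $\sum_{k=\ell}^{2m-1}$ when $2m-1<\ell$, or $\sum_{k=3}^{\ell-1}$ when $\ell-1<3$) are zero. *)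

(* Defs.v *)
From mathcomp Require Import all_boot all_order all_algebra.
From mathcomp Require Import all_classical all_reals all_analysis.
Set Implicit Arguments.
Unset Strict Implicit.
Unset Printing Implicit Defensive.
Import Order.TTheory GRing.Theory Num.Theory.
Local Open Scope classical_set_scope.
Local Open Scope ring_scope.

(* Since the leading digit [a k] is nonzero, every such [n] is positive. *)
Definition is_palindrome (b n : nat) : Prop :=
  exists (k : nat) (a : nat -> nat),
    [/\ forall i, (i <= k)%N -> (a i < b)%N,
        a k <> 0%N,
        n = (\sum_(0 <= i < k.+1) a i * b ^ i)%N
      & forall i, (i <= k)%N -> a (k - i)%N = a i].

Definition palindromes (b : nat) : set nat := [set n | is_palindrome b n].

(* A sum of nonnegative terms, taken in the extended reals: it is always
   meaningful, and the series converges in [R] iff this value is not [+oo]. *)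
Definition pal_sum (R : realType) (b : nat) : \bar R :=
  (\esum_(n in palindromes b) ((n%:R : R)^-1)%:E)%E.

(* Meant for [1 <= k]. *)
Definition pal_sum_digits (R : realType) (b k : nat) : R :=
  \sum_((b ^ (k - 1))%N <= n < (b ^ k)%N | n \in palindromes b) (n%:R)^-1.

Definition x_ (R : realType) (b : nat) : R := \sum_(1 <= a < b) (a%:R)^-1.

Definition y_ (R : realType) (b : nat) : R := \sum_(2 <= a < b.+1) (a%:R)^-1.

(* Main.v *)
Require Import Defs.
From mathcomp Require Import all_boot all_order all_algebra.
From mathcomp Require Import all_classical all_reals all_analysis.
From mathcomp Require Import zify ring lra.
Set Implicit Arguments.
Unset Strict Implicit.
Unset Printing Implicit Defensive.
Import Order.TTheory GRing.Theory Num.Theory.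
Local Open Scope ring_scope.

(* A k-digit palindrome is determined by its upper half, which is an arbitrary
   number h with uphalf k digits. Those with leading digit a therefore number
   b^(uphalf (k-2)) and lie between a(b^(k-1) + 1) and (a+1)b^(k-1) when k >= 2.
   Summing reciprocals over a bounds s_{b,k} below by a multiple of y_b and
   above by a multiple of x_b, with equality to the latter for k = 2; the
   factors b^(uphalf (k-2)) / b^(k-1) are b^-j for both k = 2j and k = 2j+1, so
   their tail from k = 2M on is 2/(b^M - b^(M-1)). *)

(** * Digits and expansions in base [b] *)

Definition digit (b n i : nat) : nat := ((n %/ b ^ i) %% b)%N.

(* The palindrome with [k] digits whose upper half is [h]: its digits in
   positions [i] and [k.-1 - i] are both read off at the larger position,
   [k./2] being the position of the lowest digit of [h]. *)
Definition mirror (b k h : nat) : nat :=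
  (\sum_(0 <= i < k) digit b h (maxn i (k.-1 - i) - k./2) * b ^ i)%N.

Section Digits.
Variable b : nat.
Hypothesis hb : (2 <= b)%N.

Let b_gt0 : (0 < b)%N. Proof. exact: ltnW. Qed.

Lemma digit_lt n i : (digit b n i < b)%N.
Proof. exact: ltn_pmod. Qed.

Lemma digit_div n i j : digit b (n %/ b ^ j)%N i = digit b n (i + j).
Proof. by rewrite /digit -divnMA -expnD addnC. Qed.

Lemma sum_digits_lt (a : nat -> nat) k : (forall i, (i < k)%N -> (a i < b)%N) ->
  (\sum_(0 <= i < k) a i * b ^ i < b ^ k)%N.
Proof.
elim: k => [|k IH] ha; first by rewrite big_nil.
rewrite big_nat_recr //= expnS.
have := IH (fun i hi => ha i (ltnW hi)); have := ha k (leqnn _).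
by nia.
Qed.

(** Uniqueness of the expansion: the part below [j] is less than [b ^ j] and dies in the division,
    the part above [j] is a multiple of [b] and dies in the remainder. *)
Lemma digit_sum (a : nat -> nat) k j : (forall i, (i < k)%N -> (a i < b)%N) ->
  (j < k)%N -> digit b (\sum_(0 <= i < k) a i * b ^ i) j = a j.
Proof.
move=> ha jk; rewrite /digit (@big_cat_nat _ _ _ j) //=; last exact: ltnW.
have -> : (\sum_(j <= i < k) a i * b ^ i =
    ((\sum_(j.+1 <= i < k) a i * b ^ (i - j.+1)) * b + a j) * b ^ j)%N.
  rewrite big_ltn // addnC mulnDl; congr addn; rewrite !big_distrl /=.
  by apply: eq_big_nat => i /andP[ji _]; rewrite -!mulnA -expnS -expnD subnK.
rewrite addnC divnMDl ?expn_gt0 ?b_gt0 //.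
rewrite (divn_small (sum_digits_lt _)); last first.
  by move=> i ij; apply: ha; exact: ltn_trans jk.
by rewrite addn0 modnMDl modn_small // ha.
Qed.

Lemma digits_sum k n : (n < b ^ k)%N ->
  n = (\sum_(0 <= i < k) digit b n i * b ^ i)%N.
Proof.
have gen : n = ((\sum_(0 <= i < k) digit b n i * b ^ i) + n %/ b ^ k * b ^ k)%N.
  elim: k => [|k IH]; first by rewrite big_nil expn0 divn1 muln1.
  rewrite big_nat_recr //= -addnA {1}IH; congr addn.
  by rewrite /digit expnSr divnMA mulnA mulnAC -mulnDl addnC -divn_eq.
by move=> nk; rewrite {1}gen divn_small // addn0.
Qed.

Lemma eq_digits k n n' : (n < b ^ k)%N -> (n' < b ^ k)%N ->
  (forall i, (i < k)%N -> digit b n i = digit b n' i) -> n = n'.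
Proof.
move=> nk n'k e; rewrite (digits_sum nk) (digits_sum n'k).
by apply: eq_big_nat => i /andP[_ ik]; rewrite e.
Qed.

(** * Palindromes as mirrored upper halves *)

(** The size of [n] forces the length in the definition, and uniqueness of digits forces the
    sequence, so both existentials disappear. *)
Lemma palindromeP k n : (b ^ k <= n < b ^ k.+1)%N ->
  is_palindrome b n <-> forall i, (i <= k)%N -> digit b n (k - i) = digit b n i.
Proof.
move=> /andP[kn nk]; split=> [[k' [a [ha ak en sa]]]|sd].
  have dn i : (i <= k')%N -> digit b n i = a i.
    by move=> ik; rewrite en digit_sum.
  have nk' : (n < b ^ k'.+1)%N by rewrite en sum_digits_lt.
  have k'n : (b ^ k' <= n)%N.
    rewrite en big_nat_recr //=; apply: leq_trans (leq_addl _ _).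
    by rewrite leq_pmull // lt0n; apply/eqP.
  have -> : k = k'.
    have kk' : (k < k'.+1)%N by rewrite -(ltn_exp2l _ _ hb) (leq_ltn_trans kn).
    have k'k : (k' < k.+1)%N by rewrite -(ltn_exp2l _ _ hb) (leq_ltn_trans k'n).
    by lia.
  by move=> i ik; rewrite !dn ?leq_subr // sa.
exists k, (digit b n); split=> //.
- by move=> i _; exact: digit_lt.
- rewrite /digit modn_small; last by rewrite ltn_divLR ?expn_gt0 ?b_gt0 // -expnS.
  by apply/eqP; rewrite -lt0n divn_gt0 // expn_gt0 b_gt0.
- exact: digits_sum.
Qed.

Lemma digit_mirror k h i : (i < k)%N ->
  digit b (mirror b k h) i = digit b h (maxn i (k.-1 - i) - k./2).
Proof. by move=> ik; rewrite digit_sum // => j _; exact: digit_lt. Qed.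

Lemma mirror_lt k h : (mirror b k h < b ^ k)%N.
Proof. by apply: sum_digits_lt => i _; exact: digit_lt. Qed.

(** Only the two extreme digits, both equal to [a], are kept. *)
Lemma mirror_ge k a c : (a < b)%N -> (c < b ^ uphalf k)%N ->
  (a * b ^ k.+1 + a <= mirror b k.+2 (a * b ^ uphalf k + c))%N.
Proof.
move=> ab cB.
have top : digit b (a * b ^ uphalf k + c) (uphalf k) = a.
  by rewrite /digit divnMDl ?expn_gt0 ?b_gt0 // divn_small // addn0 modn_small.
rewrite /mirror big_ltn // big_nat_recr //=.
have -> : (maxn 0 (k.+1 - 0) - k./2.+1 = uphalf k)%N by lia.
have -> : (maxn k.+1 (k.+1 - k.+1) - k./2.+1 = uphalf k)%N by lia.
by rewrite top; lia.
Qed.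

(** Below the leading digit [a], the remaining digits add up to less than [b ^ k.+1]. *)
Lemma mirror_le k a c : (a < b)%N -> (c < b ^ uphalf k)%N ->
  (mirror b k.+2 (a * b ^ uphalf k + c) <= a.+1 * b ^ k.+1)%N.
Proof.
move=> ab cB.
have top : digit b (a * b ^ uphalf k + c) (uphalf k) = a.
  by rewrite /digit divnMDl ?expn_gt0 ?b_gt0 // divn_small // addn0 modn_small.
rewrite /mirror big_nat_recr //=.
have -> : (maxn k.+1 (k.+1 - k.+1) - k./2.+1 = uphalf k)%N by lia.
rewrite top mulSn leq_add2r; apply: ltnW; apply: sum_digits_lt => i _.
exact: digit_lt.
Qed.

(** Digit [i] of [h] can be read off at position [i + k./2] of the mirror, where the maximum selects
    it. *)
Lemma mirror_inj k : {in [pred h | h < b ^ uphalf k]%N &, injective (mirror b k)}.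
Proof.
move=> h h'; rewrite !inE => hk h'k e; apply: (eq_digits hk h'k) => i ik.
have ik2 : (i + k./2 < k)%N by lia.
have := digit_mirror h ik2; rewrite e (digit_mirror h' ik2).
by have -> : (maxn (i + k./2) (k.-1 - (i + k./2)) - k./2 = i)%N by lia.
Qed.

Lemma mirror_div k h : (h < b ^ uphalf k)%N -> (mirror b k h %/ b ^ k./2 = h)%N.
Proof.
move=> hk.
have kE : k = (uphalf k + k./2)%N by lia.
apply: (@eq_digits (uphalf k)) => // [|i ik].
  by rewrite ltn_divLR ?expn_gt0 ?b_gt0 // -expnD -kE mirror_lt.
rewrite digit_div digit_mirror; last by lia.
by have -> : (maxn (i + k./2) (k.-1 - (i + k./2)) - k./2 = i)%N by lia.
Qed.

Lemma mem_mirror k n :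
  (n \in [seq mirror b k.+1 h | h <- index_iota (b ^ k./2) (b ^ k./2.+1)]) =
  (b ^ k <= n < b ^ k.+1)%N && (n \in palindromes b).
Proof.
have kE : k = (k./2 + uphalf k)%N by lia.
apply/mapP/andP => [[h]|[nk /set_mem]].
  rewrite mem_index_iota => /andP[h1 h2 ->].
  have hd : (mirror b k.+1 h %/ b ^ uphalf k = h)%N by exact: (@mirror_div k.+1).
  have bd : (b ^ k <= mirror b k.+1 h < b ^ k.+1)%N.
    by rewrite mirror_lt andbT {1}kE expnD -leq_divRL ?expn_gt0 ?b_gt0 // hd.
  split=> //; apply/mem_set/(palindromeP bd) => i ik.
  by rewrite !digit_mirror ?ltnS ?leq_subr //= subKn // maxnC.
move=> /(palindromeP nk) sn; have /andP[n1 n2] := nk.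
(* The upper half of [n]: of its [k.+1] digits the lowest [uphalf k] are removed. *)
exists (n %/ b ^ uphalf k)%N.
  rewrite mem_index_iota leq_divRL ?expn_gt0 ?b_gt0 // -expnD -kE n1 /=.
  by rewrite ltn_divLR ?expn_gt0 ?b_gt0 // -expnD addSn -kE.
apply: (eq_digits n2 (mirror_lt _ _)) => i ik.
rewrite digit_mirror // digit_div /=.
have -> : (maxn i (k - i) - uphalf k + uphalf k = maxn i (k - i))%N by lia.
by case: (leqP i (k - i)) => // _; rewrite sn.
Qed.

End Digits.

(** For [M >= 1], the sum of [b ^ uphalf (k - 2) / b ^ (k - 1)] over all [k >= 2M]. At [M = 0] the
    denominator vanishes and the value is 0. *)
Definition geometric_tail (R : realType) (b M : nat) : R :=
  2 / (b%:R ^+ M - b%:R ^+ (M - 1)).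

(** * Reciprocal sums for a fixed number of digits *)

Section Sums.
Variables (R : realType) (b : nat).
Hypothesis hb : (2 <= b)%N.

Local Notation tail := (geometric_tail R b).

Let b_gt0 : (0 < b)%N. Proof. exact: ltnW. Qed.

Lemma pal_sum_digitsE k : pal_sum_digits R b k.+1 =
  \sum_((b ^ k./2)%N <= h < (b ^ k./2.+1)%N) (mirror b k.+1 h)%:R^-1.
Proof.
rewrite /pal_sum_digits subn1 /= -big_filter.
rewrite -(big_map (mirror b k.+1) xpredT (fun n => n%:R^-1)).
apply: perm_big; apply: uniq_perm.
- by rewrite filter_uniq ?iota_uniq.
- rewrite map_inj_in_uniq ?iota_uniq // => h h'.
  rewrite !mem_index_iota => /andP[_ h1] /andP[_ h2].
  exact: (@mirror_inj b hb k.+1).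
- by move=> n; rewrite mem_filter mem_index_iota mem_mirror // andbC.
Qed.

Lemma big_nat_blocks (F : nat -> R) q p B : (q <= p)%N ->
  \sum_((q * B)%N <= h < (p * B)%N) F h =
  \sum_(q <= a < p) \sum_(0 <= c < B) F (a * B + c)%N.
Proof.
elim: p => [|p IH]; first by rewrite leqn0 => /eqP ->; rewrite !big_geq.
rewrite leq_eqVlt => /predU1P[->|qp]; first by rewrite !big_geq.
rewrite big_nat_recr //= -IH //.
rewrite (@big_cat_nat _ _ _ (p * B)) ?leq_mul2r ?leqnSn ?orbT //=.
  congr (_ + _); rewrite -{1}[(p * B)%N]add0n mulSn addnC -addnC big_addn addnK.
  by apply: eq_bigr => i _; rewrite addnC.
by rewrite [(q <= p)%N]qp orbT.
Qed.

(** The upper halves fill the interval from [B] to [b * B] with [B = b ^ uphalf k], which splits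
    into one block of length [B] per leading digit. *)
Lemma pal_sum_digits_by_lead k : pal_sum_digits R b k.+2 =
  \sum_(1 <= a < b) \sum_(0 <= c < (b ^ uphalf k)%N)
     (mirror b k.+2 (a * b ^ uphalf k + c))%:R^-1.
Proof.
rewrite -(big_nat_blocks (fun h => (mirror b k.+2 h)%:R^-1)) //.
by rewrite mul1n -expnS pal_sum_digitsE.
Qed.

Lemma pal_sum_digits1 : pal_sum_digits R b 1 = x_ R b.
Proof.
rewrite pal_sum_digitsE /= expn0 expn1; apply: eq_big_nat => a /andP[_ ab].
by rewrite /mirror big_nat1 /digit /= expn0 divn1 muln1 modn_small.
Qed.

(** The two-digit palindromes are the numbers [a * (b + 1)]. *)
Lemma pal_sum_digits2 : pal_sum_digits R b 2 = x_ R b / (b%:R + 1).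
Proof.
rewrite pal_sum_digits_by_lead /= expn0 mulr_suml.
apply: eq_big_nat => a /andP[_ ab].
rewrite big_nat1 muln1 addn0 /mirror 2?big_ltn // big_geq // /digit /=.
rewrite expn0 divn1 muln1 modn_small // addn0 expn1.
by rewrite -invfM -[b%:R + 1]/(b%:R + 1%:R) -natrD -natrM; congr (_%:R^-1); lia.
Qed.

Lemma x_ge0 : 0 <= x_ R b.
Proof. by apply: sumr_ge0 => a _; rewrite invr_ge0. Qed.

Lemma y_ge0 : 0 <= y_ R b.
Proof. by apply: sumr_ge0 => a _; rewrite invr_ge0. Qed.

Lemma pal_sum_digits_ge0 k : 0 <= pal_sum_digits R b k.
Proof. by apply: sumr_ge0 => a _; rewrite invr_ge0. Qed.

Lemma pal_sum_digits_le k : (2 <= k)%N -> pal_sum_digits R b k <=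
  b%:R ^+ uphalf (k - 2) / (b%:R ^+ (k - 1) + 1) * x_ R b.
Proof.
case: k => [|[|k]] // _; rewrite pal_sum_digits_by_lead subn2 subn1 /=.
rewrite mulr_sumr; apply: ler_sum_nat => a /andP[a1 ab].
apply: (@le_trans _ _ (\sum_(0 <= c < (b ^ uphalf k)%N)
    ((b%:R ^+ k.+1 + 1)^-1 * a%:R^-1))).
  apply: ler_sum_nat => c /andP[_ cB].
  rewrite -invfM -[_ + 1]/(_ + 1%:R) -natrX -natrD -natrM.
  rewrite lef_pV2 ?posrE ?ltr0n ?ler_nat.
  - by apply: leq_trans (mirror_ge hb ab cB); lia.
  - by apply: leq_trans (mirror_ge hb ab cB); lia.
  - by rewrite muln_gt0 a1 addn1.
by rewrite sumr_const_nat subn0 -[leLHS]mulr_natl natrX mulrA.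
Qed.

Lemma pal_sum_digits_ge k : (2 <= k)%N ->
  b%:R ^+ uphalf (k - 2) / b%:R ^+ (k - 1) * y_ R b <= pal_sum_digits R b k.
Proof.
case: k => [|[|k]] // _; rewrite pal_sum_digits_by_lead subn2 subn1 /=.
(* Shifting the index makes [y_] a sum of [1 / (a + 1)] over leading digits [a], to match
   [mirror_le]. *)
rewrite /y_ mulr_sumr [leLHS]big_add1 /=; apply: ler_sum_nat => a /andP[a1 ab].
apply: (@le_trans _ _ (\sum_(0 <= c < (b ^ uphalf k)%N)
    ((b%:R ^+ k.+1)^-1 * a.+1%:R^-1))); last first.
  apply: ler_sum_nat => c /andP[_ cB].
  rewrite -invfM -natrX -natrM lef_pV2 ?posrE ?ltr0n ?ler_nat.
  - by rewrite [leqRHS]mulnC mirror_le.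
  - by rewrite muln_gt0 expn_gt0 b_gt0.
  - by apply: leq_trans (mirror_ge hb ab cB); lia.
by rewrite sumr_const_nat subn0 -[leRHS]mulr_natl natrX mulrA.
Qed.

(** * The geometric series of the counting factors *)

Let b1 : (1 : R) < b%:R. Proof. by rewrite ltr1n. Qed.
Let b0 : (0 : R) < b%:R. Proof. by rewrite ltr0n. Qed.

Lemma geometric_tailE M : tail M.+1 = 2 / (b%:R ^+ M * (b%:R - 1)).
Proof.
by rewrite /geometric_tail subn1 /= exprS mulrBr mulr1 [b%:R * _]mulrC.
Qed.

Lemma sum_geometric M N : (1 <= M <= N)%N ->
  \sum_((2 * M)%N <= k < (2 * N)%N) (b%:R ^+ uphalf (k - 2) / b%:R ^+ (k - 1))
  = tail M - tail N.
Proof.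
case: M => // M /andP[_]; elim: N => // N IH.
rewrite leq_eqVlt => /predU1P[->|]; first by rewrite big_geq // subrr.
rewrite ltnS => MN; case: N IH MN => // N IH MN.
(* Two new terms appear, each equal to [b ^ -(N+1)]; together they are the difference of consecutive
   tails. *)
rewrite [(2 * N.+2)%N]mulnS addSn add1n 2?big_nat_recr ?IH //=; [|lia|lia].
have -> : uphalf (2 * N.+1 - 2) = N by lia.
have -> : uphalf (2 * N.+1 - 1) = N.+1 by lia.
have -> : (2 * N.+1 - 1 = N + N.+1)%N by lia.
have -> : ((2 * N.+1).+1 - 1 = N.+1 + N.+1)%N by lia.
rewrite !geometric_tailE !exprD !exprS.
have bN0 : b%:R ^+ N != 0 :> R by rewrite expf_neq0 // gt_eqF.
have bM0 : b%:R ^+ M != 0 :> R by rewrite expf_neq0 // gt_eqF.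
field.
by rewrite bN0 bM0 subr_eq0 !gt_eqF.
Qed.

Lemma geometric_tail_ge0 M : 0 <= tail M.
Proof.
by rewrite /geometric_tail divr_ge0 // subr_ge0 ler_weXn2l ?ltW // leq_subr.
Qed.

(** Crude, from [N < b ^ N] and [b - 1 >= 1], but enough to make the tail arbitrarily small. *)
Lemma geometric_tail_le N : tail N.+1 <= 2 / N.+1%:R.
Proof.
rewrite geometric_tailE ler_pM2l // lef_pV2 ?posrE ?ltr0n //; last first.
  by rewrite mulr_gt0 ?exprn_gt0 // subr_gt0.
rewrite -natrX -[_ - 1]/(_ - 1%:R) -natrB // -natrM ler_nat.
by apply: leq_trans (ltn_expl N hb) _; rewrite leq_pmulr // subn_gt0.
Qed.

(** * From finitely many lengths to the full series *)

Lemma sum_pal_sum_digits N : \sum_(1 <= k < N.+1) pal_sum_digits R b k =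
  \sum_(0 <= n < (b ^ N)%N | n \in palindromes b) n%:R^-1.
Proof.
elim: N => [|N IH].
  (* The only index is [n = 0], whose inverse is 0 by convention. *)
  by rewrite big_geq // expn0 big_mkcond big_nat1 invr0 if_same.
rewrite big_nat_recr //= IH.
rewrite (@big_cat_nat _ _ _ (b ^ N) 0 (b ^ N.+1)) //=; last first.
  by rewrite leq_exp2l.
by rewrite /pal_sum_digits subn1.
Qed.

Lemma pal_sumE : pal_sum R b =
  (\sum_(0 <= n <oo | n \in palindromes b) ((n%:R : R)^-1)%:E)%E.
Proof.
rewrite nneseries_esum; last by move=> n _; rewrite lee_fin invr_ge0.
by rewrite /pal_sum; congr esum; apply/seteqP; split => n /=; rewrite inE.
Qed.

Lemma pal_sum_ge N :
  ((\sum_(1 <= k < N.+1) pal_sum_digits R b k)%:E <= pal_sum R b)%E.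
Proof.
rewrite sum_pal_sum_digits pal_sumE -sumEFin.
by apply: nneseries_lim_ge => n _; rewrite lee_fin invr_ge0.
Qed.

Lemma pal_sum_le (C : R) :
  (forall N, \sum_(1 <= k < N.+1) pal_sum_digits R b k <= C) ->
  (pal_sum R b <= C%:E)%E.
Proof.
move=> hC; rewrite pal_sumE; apply: lime_le.
  by apply: is_cvg_nneseries => n _ _; rewrite lee_fin invr_ge0.
(* Since [N < b ^ N], the integers below [N] have at most [N] digits. *)
apply: nearW => N; rewrite sumEFin lee_fin; apply: le_trans (hC N).
rewrite sum_pal_sum_digits [leRHS](@big_cat_nat _ _ _ N) //=; last first.
  by rewrite ltnW // ltn_expl.
by rewrite lerDl; apply: sumr_ge0 => n _; rewrite invr_ge0.
Qed.

Lemma sum_pal_sum_digits_from3 N : (3 <= N)%N ->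
  \sum_(1 <= k < N) pal_sum_digits R b k =
  (b%:R + 2) / (b%:R + 1) * x_ R b + \sum_(3 <= k < N) pal_sum_digits R b k.
Proof.
move=> N3; rewrite big_ltn ?(leq_trans _ N3) // big_ltn // addrA.
rewrite pal_sum_digits1 pal_sum_digits2; congr (_ + _).
by field; rewrite gt_eqF // ltr_wpDl // ltW.
Qed.

(** * The two bounds *)

(** Stopping at length [2N] loses only [tail N * y_ R b], which is below any [e > 0] for large
    [N]. *)
Lemma pal_sum_lower_bound L : (2 <= L)%N ->
  (((b%:R + 2) / (b%:R + 1) * x_ R b + tail L * y_ R b
    + \sum_(3 <= k < (2 * L)%N) pal_sum_digits R b k)%:E <= pal_sum R b)%E.
Proof.
move=> L2; apply/lee_addgt0Pr => e e0.
have [n0 hn0] : exists n, 2 * y_ R b / e < n%:R.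
  by exists (Num.truncn (2 * y_ R b / e)).+1; rewrite truncnS_gt.
pose N := (maxn L n0).+1.
have tl : tail N * y_ R b <= e.
  apply: (@le_trans _ _ (2 / N%:R * y_ R b)).
    by rewrite ler_wpM2r ?y_ge0 ?geometric_tail_le.
  rewrite mulrAC ler_pdivrMr ?ltr0n // [leRHS]mulrC -ler_pdivrMr //.
  by rewrite ltW // (lt_le_trans hn0) // ler_nat; lia.
apply: (@le_trans _ _
    ((\sum_(1 <= k < (2 * N)%N) pal_sum_digits R b k)%:E + e%:E)%E);
  last first.
  rewrite leeD2r //; have -> : (2 * N = (2 * N).-1.+1)%N by lia.
  exact: pal_sum_ge.
rewrite -EFinD lee_fin sum_pal_sum_digits_from3; last by lia.
rewrite (@big_cat_nat _ _ _ (2 * L) 3 (2 * N)) //=; [|lia|lia].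
have : (tail L - tail N) * y_ R b <=
    \sum_((2 * L)%N <= k < (2 * N)%N) pal_sum_digits R b k.
  rewrite -sum_geometric; last by lia.
  rewrite mulr_suml; apply: ler_sum_nat => k /andP[k1 _].
  by apply: pal_sum_digits_ge; lia.
by rewrite mulrBl; lra.
Qed.

Lemma pal_sum_upper_bound l m : (3 <= l)%N -> (2 <= m)%N ->
  (pal_sum R b <= (((b%:R + 2) / (b%:R + 1) + tail m
      + \sum_(l <= k < (2 * m)%N)
          b%:R ^+ uphalf (k - 2) / (b%:R ^+ (k - 1) + 1)) * x_ R b
     + \sum_(3 <= k < l) pal_sum_digits R b k)%:E)%E.
Proof.
move=> l3 m2; apply: pal_sum_le => N0.
(* Large enough for [2N] to exceed [N0], [l] and [2m]; the added terms are nonnegative. *)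
pose N := (N0 + l + m)%N.
apply: (@le_trans _ _ (\sum_(1 <= k < (2 * N)%N) pal_sum_digits R b k)).
  rewrite [leRHS](@big_cat_nat _ _ _ N0.+1) //=; last by lia.
  by rewrite lerDl; apply: sumr_ge0 => n _; exact: pal_sum_digits_ge0.
rewrite sum_pal_sum_digits_from3; last by lia.
(* From length [2m] on, the [+ 1] in the denominator is dropped and the factors are summed as a
   geometric series. *)
have tl :
    \sum_((2 * m)%N <= k < (2 * N)%N) pal_sum_digits R b k <= tail m * x_ R b.
  apply: (@le_trans _ _ ((tail m - tail N) * x_ R b)); last first.
    by rewrite ler_wpM2r ?x_ge0 // lerBlDr lerDl geometric_tail_ge0.
  rewrite -sum_geometric; last by lia.
  rewrite mulr_suml; apply: ler_sum_nat => k /andP[k1 _].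
  apply: le_trans (pal_sum_digits_le _) _; first by lia.
  rewrite ler_wpM2r ?x_ge0 // ler_wpM2l ?exprn_ge0 //.
  by rewrite lef_pV2 ?posrE ?exprn_gt0 ?addr_gt0 ?exprn_gt0 // lerDl.
have [lm|ml] := leqP l (2 * m).
  rewrite (@big_cat_nat _ _ _ l 3 (2 * N)) //=; last by lia.
  rewrite (@big_cat_nat _ _ _ (2 * m) l (2 * N)) //=; last by lia.
  have : \sum_(l <= k < (2 * m)%N) pal_sum_digits R b k <=
      (\sum_(l <= k < (2 * m)%N)
          b%:R ^+ uphalf (k - 2) / (b%:R ^+ (k - 1) + 1)) * x_ R b.
    rewrite mulr_suml; apply: ler_sum_nat => k /andP[k1 _].
    by apply: pal_sum_digits_le; lia.
  by rewrite !mulrDl; lra.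
(* Here the tail begins before [l]: lengths from [2m] to [l - 1] are counted both exactly and in the
   tail, a nonnegative excess. *)
rewrite (big_geq (ltnW ml)) addr0 mulrDl.
rewrite (@big_cat_nat _ _ _ l 3 (2 * N)) //=; last by lia.
move: tl; rewrite (@big_cat_nat _ _ _ l (2 * m) (2 * N)) //=; [|lia|lia].
have : 0 <= \sum_((2 * m)%N <= k < l) pal_sum_digits R b k.
  by apply: sumr_ge0 => n _; exact: pal_sum_digits_ge0.
by lra.
Qed.

End Sums.

(* [uphalf n] is the ceiling of n/2. *)
Theorem theorem2p1 (R : realType) (b : nat) (hb : (2 <= b)%N)
    (l m : nat) (hl : (3 <= l)%N) (hm : (2 <= m)%N) :
  (((b%:R + 2) / (b%:R + 1) * x_ R b
     + 2 * y_ R b / (b%:R ^+ uphalf l - b%:R ^+ (uphalf l - 1))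
     + \sum_(3 <= k < (2 * uphalf l)%N) pal_sum_digits R b k)%:E
   <= pal_sum R b)%E
  /\
  (pal_sum R b <=
   (((b%:R + 2) / (b%:R + 1)
      + 2 / (b%:R ^+ m - b%:R ^+ (m - 1))
      + \sum_(l <= k < (2 * m)%N)
          b%:R ^+ uphalf (k - 2) / (b%:R ^+ (k - 1) + 1)) * x_ R b
     + \sum_(3 <= k < l) pal_sum_digits R b k)%:E)%E.
Proof.
split; last exact: pal_sum_upper_bound.
(* Taken at [L = uphalf l], which is at least 2 because [l >= 3]. *)
by rewrite [2 * y_ R b / _]mulrAC; apply: pal_sum_lower_bound => //; lia.
Qed.
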